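(* Consider four qubits $q_1,q_2,q_3,q_4$, where $q_1$ (data) is initially in an arbitrary pure state $|\psi\rangle=\alpha|0\rangle+\beta|1\rangle$ and the ancillas $q_2,q_3,q_4$ are initially in $|000\rangle$. Let $U_{\mathrm{enc}}$ and $U_{\mathrm{dec}}$ be the encoding and decoding circuits defined in the context. Then the scheme identifies and corrects any single Pauli error on the data qubit, the ancillas being error-free. That is, there are pairwise distinct bit strings $s_X,s_Y,s_Z\in\{0,1\}^3$, not depending on $|\psi\rangle$ and each different from the string obtained when no error occurs, such that for every $E\in\{X,Y,Z\}$ and every $|\psi\rangle$, $$U_{\mathrm{dec}}\,(E\otimes I^{\otimes 3})\,U_{\mathrm{enc}}\,(|\psi\rangle\otimes|000\rangle)=|\psi\rangle\otimes|s_E\rangle$$ up to a global phase, where $E$ acts on $q_1$.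
   Context: $\mathrm{CNOT}(a\to b)$ denotes the controlled-NOT gate with control $a$ and target $b$; $\mathrm{CCX}(a,b\to c)$ denotes the Toffoli gate with controls $a,b$ and target $c$; $H(a)$ is the Hadamard gate on $a$. Gates are listed in order of application. $U_{\mathrm{enc}}$: $\mathrm{CNOT}(q_1\to q_3)$; $H(q_1)$, $H(q_3)$; $\mathrm{CNOT}(q_1\to q_2)$, $\mathrm{CNOT}(q_3\to q_4)$. $U_{\mathrm{dec}}$: $\mathrm{CNOT}(q_1\to q_2)$, $\mathrm{CNOT}(q_3\to q_4)$; $\mathrm{CNOT}(q_2\to q_1)$, $\mathrm{CNOT}(q_4\to q_3)$; $H(q_1)$, $H(q_3)$; $\mathrm{CNOT}(q_1\to q_3)$; $\mathrm{CNOT}(q_3\to q_1)$; $\mathrm{CCX}(q_3,q_4\to q_1)$. Tensor factors are ordered $q_1,q_2,q_3,q_4$; the final computational-basis state of $(q_2,q_3,q_4)$ is called the syndrome. *)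

(* Defs.v *)
From mathcomp Require Import all_boot all_order all_algebra.
From mathcomp Require Import mxtens complex.
From mathcomp Require Import reals.

Set Implicit Arguments.
Unset Strict Implicit.
Unset Printing Implicit Defensive.

Import GRing.Theory Num.Theory.
Local Open Scope ring_scope.

Definition q1 : 'I_4 := @Ordinal 4 0 isT.
Definition q2 : 'I_4 := @Ordinal 4 1 isT.
Definition q3 : 'I_4 := @Ordinal 4 2 isT.
Definition q4 : 'I_4 := @Ordinal 4 3 isT.

Inductive pauli := PauliX | PauliY | PauliZ.

(* [CNOT a b] has control a and target b; [CCX a b c] has controls a, b and
   target c. *)
Inductive gate :=
  | CNOT of 'I_4 & 'I_4
  | CCX of 'I_4 & 'I_4 & 'I_4
  | Had of 'I_4.

(* The first gate of the list is applied first. *)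
Definition circuit := seq gate.

Definition enc : circuit :=
  [:: CNOT q1 q3; Had q1; Had q3; CNOT q1 q2; CNOT q3 q4].

Definition dec : circuit :=
  [:: CNOT q1 q2; CNOT q3 q4; CNOT q2 q1; CNOT q4 q3; Had q1; Had q3;
      CNOT q1 q3; CNOT q3 q1; CCX q3 q4 q1].

Section Semantics.
Context {C : numClosedFieldType}.

Definition ket (b : bool) : 'cV[C]_2 := delta_mx (inord b) 0.

(* States of several qubits live in right-nested Kronecker products; their
   number of columns 1 * (1 * 1), etc. is convertible to 1. *)
Definition ket3 (s : 3.-tuple bool) :=
  ket (tnth s 0) *t (ket (tnth s 1) *t ket (tnth s 2)).

Definition ket4 (x : 4.-tuple bool) :=
  ket (tnth x q1) *t (ket (tnth x q2) *t (ket (tnth x q3) *t ket (tnth x q4))).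

Definition pauli_mx (E : pauli) : 'M[C]_2 :=
  match E with
  | PauliX => delta_mx 0 1 + delta_mx 1 0
  | PauliY => 'i *: (delta_mx 1 0 - delta_mx 0 1)
  | PauliZ => delta_mx 0 0 - delta_mx 1 1
  end.

Definition hadamard_mx : 'M[C]_2 :=
  (sqrtC 2)^-1 *: \matrix_(i, j) (-1) ^+ (i * j)%N.

Definition on_qubit (a : 'I_4) (U : 'M[C]_2) : 'M[C]_(2 * (2 * (2 * 2))) :=
  let F k := if k == a then U else 1%:M in
  F q1 *t (F q2 *t (F q3 *t F q4)).

(* The linear operator sending |x> to |f x>: the sum of the |f x><x|. *)
Definition basis_map (f : 4.-tuple bool -> 4.-tuple bool) :
    'M[C]_(2 * (2 * (2 * 2))) :=
  \sum_x ket4 (f x) *m (ket4 x)^T.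

Definition xor_bit (t : 'I_4) (b : bool) (x : 4.-tuple bool) : 4.-tuple bool :=
  [tuple if k == t then tnth x k (+) b else tnth x k | k < 4].

Definition gate_mx (g : gate) : 'M[C]_(2 * (2 * (2 * 2))) :=
  match g with
  | CNOT a b => basis_map (fun x => xor_bit b (tnth x a) x)
  | CCX a b c => basis_map (fun x => xor_bit c (tnth x a && tnth x b) x)
  | Had a => on_qubit a hadamard_mx
  end.

Definition circuit_mx (c : circuit) : 'M[C]_(2 * (2 * (2 * 2))) :=
  foldl (fun U g => gate_mx g *m U) 1%:M c.

Definition pure_state (psi : 'cV[C]_2) : Prop :=
  `|psi 0 0| ^+ 2 + `|psi 1 0| ^+ 2 = 1.

Definition eq_up_to_phase m n (u v : 'M[C]_(m, n)) : Prop :=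
  exists2 c : C, `|c| = 1 & u = c *: v.

Definition with_ancillas (psi : 'cV[C]_2) (s : 3.-tuple bool) := psi *t ket3 s.

(* q2, q3, q4 are in the computational basis state |s>; a global phase is
   absorbed in the state phi of q1. *)
Definition has_syndrome v (s : 3.-tuple bool) : Prop :=
  exists2 phi, pure_state phi & v = with_ancillas phi s.

End Semantics.

(* Main.v *)
(** Up to a scalar, the errors 1, X, Z, Y are the operators X^j Z^k. After the
    first gate [enc] turns the basis input |b> into |b0b0>; the Hadamards and the
    last two gates make it the sum over a, d of (-1)^(ab + db) |a a d d> / 2.
    X^j Z^k turns the summand into (-1)^(a(b + k) + db) |a+j a d d>, which the
    first four gates of [dec] map to the same sign times |a j d 0>.  This is the
    Hadamard transform on q1, q3 of |b+k j b 0>; as that transform is an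
    involution, the Hadamards of [dec] give |b+k j b 0>, and the CNOTs |b j k 0>.
    The Toffoli gate acts trivially since q4 = 0.  So the syndrome is (j, k, 0). *)
Require Import Defs.
From mathcomp Require Import all_boot all_order all_algebra.
From mathcomp Require Import mxtens complex.
From mathcomp Require Import reals.

Import GRing.Theory Num.Theory.
Local Open Scope ring_scope.

(** * Bilinearity of the Kronecker product *)

Lemma tensmxDl (R : pzRingType) m n p q (A B : 'M[R]_(m, n)) (D : 'M[R]_(p, q)) :
  (A + B) *t D = A *t D + B *t D.
Proof. by apply/matrixP => i j; rewrite !mxE mulrDl. Qed.

Lemma tensmxDr (R : pzRingType) m n p q (A : 'M[R]_(m, n)) (B D : 'M[R]_(p, q)) :
  A *t (B + D) = A *t B + A *t D.
Proof. by apply/matrixP => i j; rewrite !mxE mulrDr. Qed.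

Lemma tensmxZl (R : pzRingType) m n p q c (A : 'M[R]_(m, n)) (B : 'M[R]_(p, q)) :
  (c *: A) *t B = c *: (A *t B).
Proof. by apply/matrixP => i j; rewrite !mxE mulrA. Qed.

Lemma tensmxZr (R : comPzRingType) m n p q c (A : 'M[R]_(m, n)) (B : 'M[R]_(p, q)) :
  A *t (c *: B) = c *: (A *t B).
Proof. by apply/matrixP => i j; rewrite !mxE mulrCA. Qed.

Lemma tensmx1 (R : pzRingType) m n : (1%:M : 'M[R]_m) *t (1%:M : 'M[R]_n) = 1%:M.
Proof.
apply/matrixP => i j; case: (mxtens_indexP i) => i1 i2; case: (mxtens_indexP j) => j1 j2.
by rewrite tensmxE !mxE (can_eq (@mxtens_indexK _ _)) xpair_eqE -natrM mulnb.
Qed.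

Section Circuits.
Set Implicit Arguments.
Unset Strict Implicit.
Variable C : numClosedFieldType.
Implicit Types (a b d j k : bool) (x y : 4.-tuple bool) (U V : 'M[C]_2).

(** * Basis kets and the action of gates on them *)

Lemma inord_bool_eq a b : (inord a == inord b :> 'I_2) = (a == b).
Proof. by rewrite -val_eqE /= !inordK; case: a; case: b. Qed.

Lemma inord_false : inord false = 0 :> 'I_2.
Proof. by apply/val_inj; rewrite /= inordK. Qed.

Lemma inord_true : inord true = 1 :> 'I_2.
Proof. by apply/val_inj; rewrite /= inordK. Qed.

Lemma tr_ket_mul_ket a b : (ket a)^T *m ket b = (a == b)%:R%:M :> 'M[C]_1.
Proof.
by rewrite trmx_delta mul_delta_mx_cond inord_bool_eq; apply/matrixP => i j;
   rewrite !ord1 mulmxnE !mxE.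
Qed.

Lemma tens_scalar11 (c e : C) : (c%:M : 'M_1) *t (e%:M : 'M_1) = (c * e)%:M.
Proof.
by rewrite -[c%:M]scalemx1 -[e%:M]scalemx1 tensmxZl tensmxZr tensmx1 scalerA scalemx1.
Qed.

(** Transposition and product act factor by factor, which leaves a Kronecker product of four 1-by-1
    deltas, multiplied from the innermost pair outwards. *)
Lemma tr_ket4_mul_ket4 x y :
  (ket4 x)^T *m ket4 y = (x == y)%:R%:M :> 'M[C]_(1 * (1 * (1 * 1))).
Proof.
rewrite /ket4 !trmx_tens !tensmx_mul !tr_ket_mul_ket.
rewrite (tens_scalar11 (tnth x q3 == tnth y q3)%:R).
rewrite (tens_scalar11 (tnth x q2 == tnth y q2)%:R).
rewrite (tens_scalar11 (tnth x q1 == tnth y q1)%:R).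
rewrite -!natrM !mulnb; congr (_%:R%:M); congr nat_of_bool.
apply/idP/eqP => [/and4P[/eqP e1 /eqP e2 /eqP e3 /eqP e4]|->]; last by rewrite !eqxx.
apply: eq_from_tnth => -[[|[|[|[|//]]]] lt_i]; rewrite ?(bool_irrelevance lt_i isT) //.
Qed.

(** By orthonormality, every summand |f y><y| with y different from x vanishes on |x>. *)
Lemma basis_map_ket4 f x : basis_map f *m ket4 x = ket4 (f x) :> 'M[C]_(_, _).
Proof.
rewrite /basis_map mulmx_suml (bigD1 x) //= big1 => [|y neq_yx].
  by rewrite -mulmxA tr_ket4_mul_ket4 eqxx mulmx1 addr0.
by rewrite -mulmxA tr_ket4_mul_ket4 (negPf neq_yx) raddf0 mulmx0.
Qed.

Lemma basis_map_sum (I : finType) f (c : I -> C) g :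
  basis_map f *m (\sum_i c i *: ket4 (g i)) = \sum_i c i *: ket4 (f (g i)).
Proof.
by rewrite mulmx_sumr; apply: eq_bigr => i _; rewrite -scalemxAr basis_map_ket4.
Qed.

Lemma mulmx_ket U b :
  U *m ket b = \sum_(a : bool) U (inord a) (inord b) *: ket a.
Proof.
rewrite big_bool -colE inord_true inord_false.
apply/colP => i; rewrite !mxE inord_true inord_false.
by case: i => -[|[|//]] lt_i; rewrite -val_eqE /= ?mulr0 ?mulr1 ?addr0 ?add0r;
  congr (U _ _); apply: val_inj.
Qed.

Definition set_bit (t : 'I_4) b x : 4.-tuple bool :=
  [tuple if k == t then b else tnth x k | k < 4].

Lemma on_qubit_ket4 t U x :
  on_qubit t U *m ket4 x
  = \sum_(b : bool) U (inord b) (inord (tnth x t)) *: ket4 (set_bit t b x).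
Proof.
rewrite /on_qubit /ket4 !tensmx_mul big_bool.
case: t => -[|[|[|[|//]]]] lt_t; rewrite (bool_irrelevance lt_t isT) /=;
  rewrite ?mul1mx mulmx_ket big_bool ?(tensmxDl, tensmxDr, tensmxZl, tensmxZr) !tnth_mktuple //.
Qed.

Lemma on_qubit_mul (a : 'I_4) U V : on_qubit a U *m on_qubit a V = on_qubit a (U *m V).
Proof.
rewrite /on_qubit !tensmx_mul.
case: a => -[|[|[|[|//]]]] lt_a; rewrite (bool_irrelevance lt_a isT) /=;
  by rewrite !mulmx1.
Qed.

Lemma on_qubitC (a b : 'I_4) U V :
  a != b -> on_qubit a U *m on_qubit b V = on_qubit b V *m on_qubit a U.
Proof.
rewrite /on_qubit !tensmx_mul.
case: a b => -[|[|[|[|//]]]] lt_a [] [|[|[|[|//]]]] lt_b //;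
  by rewrite (bool_irrelevance lt_a isT) (bool_irrelevance lt_b isT) /= ?mulmx1 ?mul1mx.
Qed.

Lemma on_qubit1 (a : 'I_4) : on_qubit a 1%:M = 1%:M :> 'M[C]_(_).
Proof. by rewrite /on_qubit !if_same !tensmx1. Qed.

(** * The Hadamard gate and explicit bit strings *)

Lemma hadamardE a b :
  hadamard_mx (inord a) (inord b) = (sqrtC 2)^-1 * (-1) ^+ (a && b) :> C.
Proof. by rewrite !mxE !inordK; case: a; case: b. Qed.

Lemma sqrtC2V_sqr : (sqrtC 2)^-1 * (sqrtC 2)^-1 = 2^-1 :> C.
Proof. by rewrite -expr2 exprVn sqrtCK. Qed.

Lemma hadamard_involutive : hadamard_mx *m hadamard_mx = 1%:M :> 'M[C]_2.
Proof.
rewrite -scalemxAl -scalemxAr scalerA sqrtC2V_sqr.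
apply/matrixP => i j; rewrite !mxE big_ord_recl big_ord1 !mxE /=.
case: i j => -[|[|//]] lt_i [] [|[|//]] lt_j;
  rewrite -val_eqE /= ?expr0 ?expr1 ?mulr1 ?mul1r ?mulrNN ?subrr ?mulr0 ?mulr1 //;
  by rewrite mulVf ?pnatr_eq0.
Qed.

Local Notation bits a b d e := [tuple a; b; d; e].

Lemma xor_bit_bits t k a b d e :
  xor_bit t k (bits a b d e) =
  bits (a (+) (t == q1) && k) (b (+) (t == q2) && k)
       (d (+) (t == q3) && k) (e (+) (t == q4) && k).
Proof.
apply: eq_from_tnth => i; rewrite tnth_mktuple.
by case: i t => -[|[|[|[|//]]]] lt_i [] [|[|[|[|//]]]] lt_t; rewrite /tnth /= ?addbF.
Qed.

Lemma set_bit_bits t k a b d e :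
  set_bit t k (bits a b d e) =
  bits (if t == q1 then k else a) (if t == q2 then k else b)
       (if t == q3 then k else d) (if t == q4 then k else e).
Proof.
apply: eq_from_tnth => i; rewrite tnth_mktuple.
by case: i t => -[|[|[|[|//]]]] lt_i [] [|[|[|[|//]]]] lt_t; rewrite /tnth.
Qed.

(** Each gate contributes a factor 1/sqrt 2 and a sign; the factors multiply to 1/2 and the sign
    exponents add modulo 2. *)
Lemma hadamard13 a b d e :
  on_qubit q3 hadamard_mx *m (on_qubit q1 hadamard_mx *m ket4 (bits a b d e))
  = \sum_(p : bool * bool) (2^-1 * (-1) ^+ ((p.1 && a) (+) (p.2 && d)))
      *: ket4 (bits p.1 b p.2 e) :> 'M[C]_(_, _).
Proof.
rewrite on_qubit_ket4 mulmx_sumr -(pair_bigA _ (fun a' d' =>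
  (2^-1 * (-1) ^+ ((a' && a) (+) (d' && d))) *: ket4 (bits a' b d' e))) /=.
apply: eq_bigr => a' _; rewrite -scalemxAr on_qubit_ket4 scaler_sumr.
apply: eq_bigr => d' _; rewrite !set_bit_bits !hadamardE /= !scalerA -sqrtC2V_sqr.
by rewrite !(tnth_nth false) /= signr_addb mulrACA.
Qed.

(** * Following a basis state through the circuits *)

Lemma circuit_mx_mul (c : circuit) n (v : 'M[C]_(_, n)) :
  circuit_mx c *m v = foldl (fun v g => gate_mx g *m v) v c.
Proof.
rewrite /circuit_mx -[v in RHS]mul1mx.
by elim: c 1%:M => //= g c IHc A; rewrite IHc mulmxA.
Qed.

(* [U] is, up to the scalar [c], the Pauli operator X^j Z^k. *)
Definition is_pauli (U : 'M[C]_2) (c : C) j k :=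
  forall a b, U (inord a) (inord b) = c * (-1) ^+ (k && b) * (a == b (+) j)%:R.

(** Each column of [U] has a single nonzero entry, so one term of the expansion of [on_qubit_ket4]
    survives. *)
Lemma on_qubit_is_pauli t U c j k x : is_pauli U c j k ->
  on_qubit t U *m ket4 x
  = (c * (-1) ^+ (k && tnth x t)) *: ket4 (xor_bit t j x).
Proof.
move=> Uxz; have -> : xor_bit t j x = set_bit t (tnth x t (+) j) x.
  apply: eq_from_tnth => i; rewrite !tnth_mktuple.
  by case: eqP => // ->.
rewrite on_qubit_ket4 (bigD1 (tnth x t (+) j)) //= big1 => [|b neq_b].
  by rewrite Uxz eqxx mulr1 addr0.
by rewrite Uxz (negPf neq_b) mulr0 scale0r.
Qed.

(** Gates on distinct qubits commute, so equal Hadamards can be made adjacent and cancel. *)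
Lemma hadamard13_involutive n (v : 'M[C]_(_, n)) :
  on_qubit q3 hadamard_mx *m (on_qubit q1 hadamard_mx
    *m (on_qubit q3 hadamard_mx *m (on_qubit q1 hadamard_mx *m v))) = v.
Proof.
rewrite (mulmxA (on_qubit q1 _) (on_qubit q3 _)) on_qubitC // -mulmxA.
rewrite (mulmxA (on_qubit q1 _) (on_qubit q1 _)) on_qubit_mul hadamard_involutive.
by rewrite on_qubit1 mul1mx mulmxA on_qubit_mul hadamard_involutive on_qubit1 mul1mx.
Qed.

Lemma decode_ket U c j k b : is_pauli U c j k ->
  circuit_mx dec *m on_qubit q1 U *m circuit_mx enc *m ket4 (bits b false false false)
  = c *: ket4 (bits b j k false).
Proof.
move=> Uxz; rewrite -2!mulmxA (circuit_mx_mul enc) /=.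
rewrite basis_map_ket4 xor_bit_bits !(tnth_nth false) /= !(addbF, addFb).
rewrite hadamard13 !basis_map_sum mulmx_sumr.
under eq_bigr => p _ do rewrite -scalemxAr (on_qubit_is_pauli _ _ Uxz) scalerA
   !(xor_bit_bits, tnth_nth false) /= !(addbF, addFb, andbT).
(* The first four gates of [dec] permute the basis, so they only relabel the kets under the sum. *)
rewrite circuit_mx_mul /= !basis_map_sum.
(* What remains is [dec] from its Hadamards on. The sign of the error is absorbed by replacing b
   with b + k in the exponent of the first qubit. *)
transitivity (circuit_mx (drop 4 dec) *m (c *: \sum_(p : bool * bool)
  (2^-1 * (-1) ^+ ((p.1 && (b (+) k)) (+) (p.2 && b)))
    *: ket4 (bits p.1 j p.2 false))).
  rewrite circuit_mx_mul /=; congr (_ *m (_ *m (_ *m (_ *m (_ *m _))))).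
  rewrite scaler_sumr; apply: eq_bigr => p _.
  rewrite scalerA !(xor_bit_bits, tnth_nth false) /= !(addbF, addFb, andbT).
  rewrite mulrACA -signr_addb (mulrC 2^-1) -mulrA.
  congr (_ * (_ * _ ^+ nat_of_bool _) *: ket4 _).
    by clear Uxz; case: p b k => [[] []] [] [].
  by congr [tuple of [:: _; _; _; _]]; clear Uxz; case: p j => [[] []] [].
(* The sum is read backwards as the Hadamard transform of |b+k j b 0>. *)
rewrite -hadamard13 -scalemxAr circuit_mx_mul /=; congr (_ *: _).
rewrite hadamard13_involutive !basis_map_ket4.
rewrite !(xor_bit_bits, tnth_nth false) /= !(addbF, addFb, andbT, andbF).
by congr (ket4 [tuple of [:: _; _; _; _]]); clear; case: b k => [] [].
Qed.

(** * Extension to arbitrary data states *)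

Lemma with_ancillasE (psi : 'cV[C]_2) b2 b3 b4 :
  with_ancillas psi [tuple b2; b3; b4]
  = \sum_(b : bool) psi (inord b) 0 *: ket4 (bits b b2 b3 b4).
Proof.
transitivity ((\sum_(b : bool) psi (inord b) 0 *: ket b)
    *t ket3 [tuple b2; b3; b4]).
  congr (_ *t _); apply/colP => i.
  rewrite big_bool inord_true inord_false !mxE inord_true inord_false.
  case: i => -[|[|//]] lt_i; rewrite -val_eqE /= ?mulr0 ?mulr1 ?addr0 ?add0r;
    by congr (psi _ _); apply: val_inj.
by rewrite !big_bool tensmxDl !tensmxZl.
Qed.

(** In [decode_ket] neither [c] nor the syndrome depends on the data bit, so linearity carries the
    result over to superpositions. *)
Lemma decode_with_ancillas U c j k psi : is_pauli U c j k ->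
  circuit_mx dec *m on_qubit q1 U *m circuit_mx enc
    *m with_ancillas psi [tuple false; false; false]
  = c *: with_ancillas psi [tuple j; k; false].
Proof.
move=> Uxz; rewrite !with_ancillasE mulmx_sumr scaler_sumr; apply: eq_bigr => b _.
by rewrite -scalemxAr (decode_ket _ Uxz) !scalerA mulrC.
Qed.

(** * The Pauli matrices in the form X^j Z^k *)

Lemma is_pauli1 : is_pauli 1%:M 1 false false.
Proof. by move=> a b; rewrite !mxE inord_bool_eq addbF mulr1 mul1r. Qed.

Lemma is_pauliX : is_pauli (pauli_mx PauliX) 1 true false.
Proof.
by move=> [] []; rewrite ?inord_true ?inord_false !mxE /= ?mulr1 ?mulr0 ?addr0 ?add0r.
Qed.

Lemma is_pauliZ : is_pauli (pauli_mx PauliZ) 1 false true.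
Proof.
by move=> [] []; rewrite ?inord_true ?inord_false !mxE /= ?mulr1 ?mulr0 ?mul1r ?subr0 ?sub0r.
Qed.

(** The scalar comes from Y = i X Z. *)
Lemma is_pauliY : is_pauli (pauli_mx PauliY) 'i true true.
Proof.
by move=> [] []; rewrite ?inord_true ?inord_false !mxE /= ?(mulr1, mulr0, subr0, sub0r).
Qed.

End Circuits.

Theorem mainTheorem3 (R : realType) :
  exists (s : pauli -> 3.-tuple bool) (s0 : 3.-tuple bool),
    [/\ injective s,
        forall E : pauli, s E <> s0,
        forall psi : 'cV[R[i]]_2, pure_state psi ->
          has_syndrome
            (circuit_mx dec *m circuit_mx enc
               *m with_ancillas psi [tuple false; false; false]) s0
      & forall (E : pauli) (psi : 'cV[R[i]]_2), pure_state psi ->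
          eq_up_to_phase
            (circuit_mx dec *m on_qubit q1 (pauli_mx E) *m circuit_mx enc
               *m with_ancillas psi [tuple false; false; false])
            (with_ancillas psi (s E))].
Proof.
(* The syndrome is (j, k, 0), with (j, k) the exponents in X^j Z^k: (1, 0) for X, (1, 1) for Y, (0,
   1) for Z. *)
exists (fun E => match E with
  | PauliX => [tuple true; false; false]
  | PauliY => [tuple true; true; false]
  | PauliZ => [tuple false; true; false]
  end), [tuple false; false; false].
split=> [[] [] // /(congr1 val) // | [] /(congr1 val) // | psi pure | [] psi _].
(* The absence of an error is the case [U] = 1, j = k = 0 of the same computation. *)
- exists psi => //; have := decode_with_ancillas psi (is_pauli1 _).
  by rewrite on_qubit1 mulmx1 scale1r.
- by exists 1; [rewrite normr1 | rewrite (decode_with_ancillas _ (is_pauliX _))].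
- by exists 'i; [rewrite normCi | rewrite (decode_with_ancillas _ (is_pauliY _))].
- by exists 1; [rewrite normr1 | rewrite (decode_with_ancillas _ (is_pauliZ _))].
Qed.
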